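(* Let $T$ be a contraction on a Banach space $\mathbb{X}$ and let $\mathbb{X}(T)=\{x\in\mathbb{X}:\|T^nx\|=\|x\|,\ n\in\mathbb{N}\}$ be a linear subspace of $\mathbb{X}$. If $T|_{\mathbb{X}(T)}$ is a Wold isometry with right-complemented range, then there is a unique closed subspace $\mathbb{W}$ of $\mathbb{X}$ such that (a) $\mathbb{W}$ is invariant under $T$; (b) $T|_{\mathbb{W}}:\mathbb{W}\to\mathbb{W}$ is a unitary; (c) if $\mathbb{M}$ is an invariant subspace of $T$ for which $T|_{\mathbb{M}}:\mathbb{M}\to\mathbb{M}$ is a unitary, then $\mathbb{M}\subseteq\mathbb{W}$. In addition, if $\mathbb{W}$ is smooth and $\mathbb{X}=\mathbb{W}\bigoplus_{\mathsf R}\mathbb{W}'$, then $T|_{\mathbb{W}'}$ is a completely non-unitary contraction.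
   Context: Banach spaces are over the complex field. A contraction is a bounded linear operator with $\|T\|\le 1$; an isometry is a linear norm-preserving map; a unitary is a surjective isometry. Subspaces are linear. The restriction $T|_{\mathbb{X}(T)}$ is regarded as an operator on $\mathbb{X}(T)$. A Banach space $\mathbb{E}$ is smooth if each nonzero $x\in\mathbb{E}$ is smooth, that is, there is exactly one $f\in\mathbb{E}^*$ with $\|f\|=\|x\|$ and $f(x)=\|x\|^2$. $x\perp_B y$ means $\|x+\lambda y\|\ge\|x\|$ for all $\lambda\in\mathbb{C}$; for subspaces it is required for all pairs of elements. A closed subspace $\mathbb{Y}$ of a Banach space $\mathbb{E}$ is right-complemented, with right complement $\widetilde{\mathbb{Y}}$, written $\mathbb{E}=\mathbb{Y}\bigoplus_{\mathsf R}\widetilde{\mathbb{Y}}$, if $\widetilde{\mathbb{Y}}$ is a closed vector space complement of $\mathbb{Y}$ with $\mathbb{Y}\perp_B\widetilde{\mathbb{Y}}$. A Wold isometry on a Banach space $\mathbb{E}$ is an isometry $V:\mathbb{E}\to\mathbb{E}$ such that $\mathbb{E}=\mathbb{E}_1\oplus\mathbb{E}_2$ (every element is uniquely a sum of an element of $\mathbb{E}_1$ and an element of $\mathbb{E}_2$) with $\mathbb{E}_1,\mathbb{E}_2$ invariant subspaces of $V$, $V|_{\mathbb{E}_1}$ a unitary and $V|_{\mathbb{E}_2}$ a pure isometry (an isometry with no unitary part, i.e. with no nonzero closed invariant subspace on which it is a unitary). A contraction $S$ on a Banach space $\mathbb{E}$ is completely non-unitary if there is no nonzero invariant subspace $\mathbb{Y}$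 of $\mathbb{E}$ such that $S|_{\mathbb{Y}}:\mathbb{Y}\to\mathbb{Y}$ is a unitary.
   Formalization: ''W is smooth'' is taken to mean that each nonzero x in W has exactly one support functional in X* (not W* ); with W* the last claim fails: X = ℓ¹₂, T(a,b) = (a+b/2, 0), W = {b=0}, W' = {a=0}, where T does not map W' into W'. *)

(* Defs.v *)
From HB Require Import structures.
From mathcomp Require Import all_boot all_order all_algebra.
From mathcomp Require Import all_classical all_reals all_analysis.
From mathcomp.real_closed Require Import complex.

Set Implicit Arguments.
Unset Strict Implicit.
Unset Printing Implicit Defensive.

Import Order.TTheory GRing.Theory Num.Theory.
Import numFieldNormedType.Exports.
Local Open Scope classical_set_scope.
Local Open Scope ring_scope.
Local Open Scope complex_scope.

(* MathComp-Analysis norms on a complex space take (real, nonnegative) values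
   in R[i]; `rnorm` is the same number seen in R. *)
Definition rnorm (R : realType) (V : normedModType R[i]) (x : V) : R :=
  complex.Re `|x|.

Section Subspaces.
Context {R : realType} {X : normedModType R[i]}.
Implicit Types (E Y Z : set X) (x y : X).

Definition linear_subspace Y : Prop := submod_closed (mem Y).

(* Banach spaces that arise as subspaces of X are represented by their carrier
   E : set X; topological notions "in E" refer to the induced topology. *)
Definition closed_in E Y : Prop := Y `<=` E /\ closure Y `&` E `<=` Y.

Definition direct_sum E Y Z : Prop :=
  [/\ Y `<=` E, Z `<=` E &
      forall x, E x -> exists! p : X * X, [/\ Y p.1, Z p.2 & x = p.1 + p.2]].

Definition BJ_orthogonal x y : Prop :=
  forall l : R[i], `|x + l *: y| >= `|x|.

(* E = Y (+)_R Z *)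
Definition right_complement E Y Z : Prop :=
  [/\ linear_subspace Y, closed_in E Y, linear_subspace Z, closed_in E Z & direct_sum E Y Z]
  /\ (forall y z, Y y -> Z z -> BJ_orthogonal y z).

Definition right_complemented E Y : Prop := exists Z, right_complement E Y Z.

End Subspaces.

Section Operators.
Context {R : realType} {X V : normedModType R[i]}.

Definition bounded_on (E : set X) (f : X -> V) : Prop :=
  exists M : R, forall x, E x -> rnorm (f x) <= M * rnorm x.

(* The operator norm of f restricted to E. *)
Definition opnorm (E : set X) (f : X -> V) : R :=
  sup [set rnorm (f x) | x in E `&` [set x | rnorm x <= 1]].

End Operators.

Section Smoothness.
Context {R : realType} {X : normedModType R[i]}.

Definition support_functional (x : X) (f : X -> R[i]^o) : Prop :=
  [/\ linear f, bounded_on setT f, opnorm setT f = rnorm x &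
      f x = `|x| ^+ 2].

Definition smooth_point (x : X) : Prop := exists! f, support_functional x f.

(* The functionals are taken on the ambient space X. For Y = setT this is
   smoothness of X. Smoothness of Y as a space of its own, with functionals on
   Y, is weaker: every line in X has it. *)
Definition smooth (Y : set X) : Prop :=
  forall x, Y x -> x != 0 -> smooth_point x.

End Smoothness.

Section Restrictions.
Context {R : realType} {X : normedModType R[i]}.
Context (T : {linear X -> X}).
Implicit Types E Y Z M W : set X.

Definition invariant_subspace Y : Prop := linear_subspace Y /\ T @` Y `<=` Y.

(* For a subspace E, the predicates `P_on T E` say that T restricts to an
   operator E -> E and that this operator has the property P. *)
Definition contraction_on E : Prop :=
  [/\ invariant_subspace E, bounded_on E T & opnorm E T <= 1].

Definition isometry_on E : Prop :=
  invariant_subspace E /\ (forall x, E x -> `|T x| = `|x|).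

Definition unitary_on E : Prop := isometry_on E /\ T @` E = E.

Definition pure_isometry_on E : Prop :=
  isometry_on E /\
  ~ (exists Y, [/\ closed_in E Y, Y <> [set 0], invariant_subspace Y & unitary_on Y]).

Definition Wold_isometry_on E : Prop :=
  isometry_on E /\
  (exists E1 E2, [/\ direct_sum E E1 E2, invariant_subspace E1, invariant_subspace E2,
                     unitary_on E1 & pure_isometry_on E2]).

Definition completely_nonunitary_on E : Prop :=
  ~ (exists Y, [/\ Y `<=` E, Y <> [set 0], invariant_subspace Y & unitary_on Y]).

(* The set X(T). *)
Definition norm_preserved : set X :=
  [set x | forall n : nat, `|iter n T x| = `|x|].

Definition largest_unitary_subspace W : Prop :=
  [/\ linear_subspace W /\ closed W,
      invariant_subspace W,
      unitary_on W &
      forall M, invariant_subspace M -> unitary_on M -> M `<=` W].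

End Restrictions.

(* Main.v *)
(* On E = X(T) the operator T is an isometry of a complete space, so each T^n E
   is closed, and W = \bigcap_n T^n E is the largest subspace on which T is
   unitary: any other one satisfies M = T^n M and lies in E.
   If X = W (+)_R W', the projection P onto W along W' has norm one. For w in W
   with unique support functional f, f \o P is again a support functional, so f
   vanishes on W', which forces T W' into W'. A unitary part of T in W' would lie
   in both W and W'. *)

Require Import Defs.
From mathcomp Require Import all_boot all_order all_algebra.
From mathcomp Require Import all_classical all_reals all_analysis.
From mathcomp.real_closed Require Import complex.

Import Order.TTheory GRing.Theory Num.Theory.
Import numFieldNormedType.Exports.

Local Open Scope classical_set_scope.
Local Open Scope ring_scope.
Local Open Scope complex_scope.

(** * Passing between real-valued and complex-valued norms *)

Section Norms.
Context {R : realType} {V : normedModType R[i]}.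
Implicit Types x y : V.

Lemma rnormE x : (rnorm x)%:C = `|x|.
Proof. by rewrite /rnorm RRe_real // ger0_real. Qed.

Lemma rnorm_ge0 x : 0 <= rnorm x.
Proof. by rewrite -lecR rnormE; exact: normr_ge0. Qed.

Lemma rnorm0 : rnorm (0 : V) = 0.
Proof. by rewrite /rnorm normr0. Qed.

Lemma rnorm_eq0 x : (rnorm x == 0) = (x == 0).
Proof. by rewrite -(inj_eq (@complexI R)) rnormE normr_eq0. Qed.

Lemma rnormZ (a : R) x : 0 <= a -> rnorm (a%:C *: x) = a * rnorm x.
Proof.
move=> a0; apply: (@complexI R).
by rewrite rmorphM /= !rnormE normrZ ger0_norm // lecR.
Qed.

End Norms.

Lemma ler_rnorm (R : realType) (X V : normedModType R[i]) (x : X) (y : V) :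
  (rnorm x <= rnorm y) = (`|x| <= `|y|).
Proof. by rewrite -lecR !rnormE. Qed.

(** * The operator norm as a supremum over the unit ball *)

Section OperatorNorm.
Context {R : realType} {X V : normedModType R[i]}.
Implicit Types (E : set X) (f : X -> V).

Lemma opnorm_le E f (C : R) : E 0 ->
  (forall x, E x -> rnorm x <= 1 -> rnorm (f x) <= C) -> opnorm E f <= C.
Proof.
move=> E0 fC; apply: ge_sup; last by move=> _ [x [Ex x1] <-]; exact: fC.
by exists (rnorm (f 0)), 0 => //; split => //=; rewrite rnorm0.
Qed.

Lemma rnorm_le_opnorm E f x : bounded_on E f -> E x -> rnorm x <= 1 ->
  rnorm (f x) <= opnorm E f.
Proof.
move=> [M fM] Ex x1; apply: ub_le_sup; last by exists x.
(* No sign is imposed on [M], so the bound over the unit ball is [|M|]. *)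
exists `|M| => _ [y [Ey y1] <-]; apply: (le_trans (fM _ Ey)).
have y0 := rnorm_ge0 y.
apply: (le_trans (ler_wpM2r y0 (ler_norm M))).
by rewrite ler_piMr.
Qed.

Lemma linear_map0 f : linear f -> f 0 = 0.
Proof.
move=> /(_ 1 0 0); rewrite scaler0 addr0 scale1r => /eqP.
by rewrite -subr_eq subrr eq_sym => /eqP.
Qed.

(** By homogeneity it suffices to evaluate [f] at [x] divided by its norm; [x = 0] is treated
    apart. *)
Lemma rnorm_le_opnormM f x : linear f -> bounded_on setT f ->
  rnorm (f x) <= opnorm setT f * rnorm x.
Proof.
move=> lf bf.
have fZ a y : f (a *: y) = a *: f y by have := lf a y 0; rewrite linear_map0 // !addr0.
have [->|x0] := eqVneq x 0.
  by rewrite linear_map0 // !rnorm0 mulr0.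
have nx0 : 0 < rnorm x by rewrite lt_neqAle eq_sym rnorm_eq0 x0 rnorm_ge0.
have nV0 : 0 <= (rnorm x)^-1 by rewrite invr_ge0 rnorm_ge0.
rewrite -ler_pdivrMr // mulrC -rnormZ // -fZ.
by apply: rnorm_le_opnorm; rewrite // rnormZ // mulVf // rnorm_eq0.
Qed.

End OperatorNorm.

(** * Stability properties of linear subspaces *)

Section Subspaces.
Context {R : realType} {X : normedModType R[i]}.
Implicit Types Y : set X.

Lemma linear_subspaceP Y :
  linear_subspace Y <-> Y 0 /\ (forall a u v, Y u -> Y v -> Y (a *: u + v)).
Proof.
split=> [[Y0 YD]|[Y0 YD]]; split.
- by move: Y0; rewrite inE.
- by move=> a u v Yu Yv; apply/set_mem/YD; apply/mem_set.
- exact/mem_set.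
- by move=> a u v /set_mem Yu /set_mem Yv; apply/mem_set/YD.
Qed.

Lemma linear_subspace_sub Y u v : linear_subspace Y -> Y u -> Y v -> Y (u - v).
Proof.
by move=> /linear_subspaceP[_ YD] Yu Yv; rewrite addrC -scaleN1r; apply: YD.
Qed.

Lemma linear_subspace_bigcap (I : Type) (F : I -> set X) :
  (forall i, linear_subspace (F i)) -> linear_subspace (\bigcap_i F i).
Proof.
move=> lF; apply/linear_subspaceP; split=> [i _|a u v Fu Fv i _].
  by case/linear_subspaceP: (lF i).
by case/linear_subspaceP: (lF i) => _; apply; [exact: Fu | exact: Fv].
Qed.

Lemma linear_subspace_image (T : {linear X -> X}) Y :
  linear_subspace Y -> linear_subspace (T @` Y).
Proof.
move=> /linear_subspaceP[Y0 YD]; apply/linear_subspaceP; split.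
  by exists 0; rewrite ?linear0.
move=> a _ _ [u Yu <-] [v Yv <-].
by exists (a *: u + v); rewrite ?linearP //; exact: YD.
Qed.

End Subspaces.

(** * The norm-one projection given by a right complement *)

Section Projection.
Context {R : realType} {X : normedModType R[i]}.
Implicit Types W : set X.

Lemma complement_projection {W W' : set X} : right_complement setT W W' ->
  exists P : X -> X,
    [/\ linear P, (forall x, W (P x) /\ W' (x - P x)),
        (forall w w', W w -> W' w' -> P (w + w') = w)
      & (forall x, `|P x| <= `|x|)].
Proof.
move=> [[/[dup] lW /linear_subspaceP[W0 WD] _ lW' _ [_ _ sum]] orth].
have /linear_subspaceP[W'0 W'D] := lW'.
have [p hp] : {p : X -> X * X & forall x,
    unique (fun p => [/\ W p.1, W' p.2 & x = p.1 + p.2]) (p x)}.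
  by apply: (@choice _ _ (fun x y => unique _ y)) => x; exact: sum.
pose P x := (p x).1.
have PP x : W (P x) /\ W' (x - P x).
  have [[Wp W'p e] _] := hp x.
  by have -> : x - P x = (p x).2 by rewrite {1}e addrC addKr.
have PE w w' : W w -> W' w' -> P (w + w') = w.
  by move=> Ww Ww'; rewrite /P (proj2 (hp (w + w')) (w, w')).
exists P; split => //.
- move=> a x y; have [Wx W'x] := PP x; have [Wy W'y] := PP y.
  (* Linearity comes from uniqueness: combining the decompositions of [x] and [y] decomposes
     [a *: x + y]. *)
  rewrite -[RHS](PE (a *: P x + P y) (a *: (x - P x) + (y - P y)));
    [|exact: WD|exact: W'D].
  by rewrite addrACA -scalerDr !subrKC.
- move=> x; have [Wx W'x] := PP x.
  (* Orthogonality at the scalar 1 compares [P x] with [P x + (x - P x) = x]. *)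
  by have := orth _ _ Wx W'x 1; rewrite scale1r subrKC.
Qed.

End Projection.

(** * Support functionals as pointwise bounds, and smoothness *)

Section SupportFunctionals.
Context {R : realType} {X : normedModType R[i]}.
Implicit Types (w : X) (f : X -> R[i]^o).

Lemma support_functional_le {w f} : support_functional w f ->
  forall x, `|f x| <= `|w| * `|x|.
Proof.
move=> [lf bf fw _] x; have := rnorm_le_opnormM _ x lf bf.
by rewrite fw -lecR rmorphM /= !rnormE.
Qed.

(** The pointwise bound gives one inequality for the operator norm. Evaluation at [w], where [f w]
    is the squared norm, gives the other after division by the norm of [w]. *)
Lemma support_functional_intro w f : linear f ->
  (forall x, `|f x| <= `|w| * `|x|) -> f w = `|w| ^+ 2 -> support_functional w f.
Proof.
move=> lf fle fw.
have fler x : rnorm (f x) <= rnorm w * rnorm x.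
  by rewrite -lecR rmorphM /= !rnormE.
have bf : bounded_on setT f by exists (rnorm w) => x _.
split=> //; apply/eqP; rewrite eq_le; apply/andP; split.
  apply: opnorm_le => // x _ x1; apply: (le_trans (fler x)).
  by rewrite ler_piMr ?rnorm_ge0.
have [->|w0] := eqVneq w 0.
  by rewrite rnorm0 (le_trans _ (rnorm_le_opnorm _ _ 0 bf _ _)) ?rnorm_ge0 ?rnorm0.
have nw0 : 0 < rnorm w by rewrite lt_neqAle eq_sym rnorm_eq0 w0 rnorm_ge0.
rewrite -(ler_pM2r nw0); apply: le_trans (rnorm_le_opnormM _ w lf bf).
by rewrite -lecR rmorphM /= !rnormE fw normrX normr_id expr2.
Qed.

Lemma smooth_support_functional_eq {w f g} : smooth_point w ->
  support_functional w f -> support_functional w g -> f = g.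
Proof. by move=> [h [_ hU]] /hU <- /hU <-. Qed.

(* If P is the projection onto W along W', then P is a contraction because
   W is orthogonal to W', so f \o P is again a support functional at w. *)
Lemma support_functional_vanish {W W' : set X} {w f} :
  right_complement setT W W' -> W w -> smooth_point w ->
  support_functional w f -> forall w', W' w' -> f w' = 0.
Proof.
move=> cW Ww sw sf.
have [P [lP _ PE Ple]] := complement_projection cW.
have [[/linear_subspaceP[W0 _] _ /linear_subspaceP[W'0 _] _ _] _] := cW.
have [lf _ _ fw] := sf.
have -> : f = f \o P.
  apply: (smooth_support_functional_eq sw sf); apply: support_functional_intro.
  - by move=> a x y /=; rewrite lP lf.
  - move=> x /=; apply: (le_trans (support_functional_le sf _)).
    by apply: ler_wpM2l.
  - by rewrite /= -{1}[w]addr0 PE.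
move=> w' W'w' /=; rewrite -[w']add0r PE //.
exact: linear_map0.
Qed.

End SupportFunctionals.

(** * Contractions, the space X(T), and invariance of the complement *)

Section Contractions.
Context {R : realType} {X : normedModType R[i]} {T : {linear X -> X}}.
Hypothesis hT : contraction_on T setT.

Lemma contraction_le x : `|T x| <= `|x|.
Proof.
have [_ bT T1] := hT.
rewrite -ler_rnorm; apply: (le_trans (rnorm_le_opnormM _ _ (linearP T) bT)).
by rewrite ler_piMl ?rnorm_ge0.
Qed.

Lemma contraction_continuous : continuous T.
Proof.
move=> x; apply/cvgrPdist_lt => e e0.
near=> y; rewrite -linearB; apply: (le_lt_trans (contraction_le _)).
by near: y; apply: cvgr_dist_lt.
Unshelve. all: by end_near. Qed.

Lemma iter_contraction_continuous n : continuous (iter n T).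
Proof.
elim: n => [|n IH] x /=; first exact: cvg_id.
by apply: continuous_comp; [exact: IH | exact: contraction_continuous].
Qed.

Lemma norm_preserved_closed : closed (norm_preserved T).
Proof.
(* Each condition defining X(T) is the zero set of a continuous function. *)
pose g n (x : X) : R[i]^o := `|iter n T x| - `|x|.
have -> : norm_preserved T = \bigcap_n g n @^-1` [set 0].
  apply/seteqP; split=> [x Ex n _ /=|x Ex n]; first by rewrite /g Ex subrr.
  by apply/eqP; rewrite -subr_eq0; apply/eqP; exact: (Ex n).
apply: closed_bigI => n _; apply: (@preimage_closed _ _ (g n)).
  move=> x _; apply: cvgB; last exact: norm_continuous.
  apply: continuous_comp; last exact: norm_continuous.
  exact: iter_contraction_continuous.
exact/accessible_closed_set1/hausdorff_accessible/norm_hausdorff.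
Qed.

Lemma norm_preserved_isometry x : norm_preserved T x -> `|T x| = `|x|.
Proof. by move=> /(_ 1%N). Qed.

Lemma norm_preserved_stable x : norm_preserved T x -> norm_preserved T (T x).
Proof. by move=> Ex n; rewrite -iterSr Ex norm_preserved_isometry. Qed.

Lemma unitary_norm_preserved M : unitary_on T M -> M `<=` norm_preserved T.
Proof.
move=> [[[_ TM] isoM] _] x Mx n.
(* Membership in [M] is carried through the induction, since [T] is known to be isometric only
   there. *)
suff [] : M (iter n T x) /\ `|iter n T x| = `|x| by [].
by elim: n => //= n [Mn <-]; split; [apply: TM; exists (iter n T x) | exact: isoM].
Qed.

Lemma contraction_on_invariant E : invariant_subspace T E -> contraction_on T E.
Proof.
move=> iE; split => //.
  by exists 1 => x _; rewrite mul1r ler_rnorm contraction_le.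
have [/linear_subspaceP[E0 _] _] := iE.
by apply: opnorm_le => // x _; apply: le_trans; rewrite ler_rnorm contraction_le.
Qed.

(* Let a be the W-component of T w', let a = T w, and let f be the support
   functional at a. Since T is isometric on W, f \o T is the support functional
   at w, so both f and f \o T vanish on W'; thus 0 = f (T w') = f a = |a|^2. *)
Lemma smooth_complement_invariant (W W' : set X) : unitary_on T W -> smooth W ->
  right_complement setT W W' -> T @` W' `<=` W'.
Proof.
move=> [[_ isoW] TW] sW cW _ [w' W'w' <-].
have [P [lP PP _ _]] := complement_projection cW.
have [] := PP (T w'); set a := P _; set b := _ - a => Wa W'b.
suff a0 : a = 0 by move: W'b; rewrite /b a0 subr0.
apply/eqP; apply: contraT => a0.
have [w Ww Tw] : (T @` W) a by rewrite TW.
have w0 : w != 0 by apply: contraNneq a0 => w0; rewrite -Tw w0 linear0.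
have sa := sW _ Wa a0; have [f [sf _]] := sa; have [lf _ _ fa] := sf.
have sg : support_functional w (f \o T).
  apply: support_functional_intro.
  - by move=> c x y /=; rewrite linearP lf.
  - move=> x /=; apply: (le_trans (support_functional_le sf _)).
    by rewrite -Tw isoW // ler_wpM2l // contraction_le.
  - by rewrite /= Tw fa -Tw isoW.
have /= := support_functional_vanish cW Ww (sW _ Ww w0) sg _ W'w'.
rewrite -(subrK a (T w')) -/b -[b]scale1r lf.
rewrite (support_functional_vanish cW Wa sa sf _ W'b) fa scaler0 add0r.
by move=> /eqP; rewrite expf_eq0 /= normr_eq0 (negbTE a0).
Qed.

End Contractions.

(** * Images under the isometry and the largest unitary part *)

Section LargestUnitary.
Context {R : realType} {X : completeNormedModType R[i]} {T : {linear X -> X}}.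
Hypothesis hT : contraction_on T setT.
Hypothesis hXT : linear_subspace (norm_preserved T).

(** Completeness enters here: points of [F] whose images approach [x] form a Cauchy filter because
    [T] preserves distances on [F], and [T] maps its limit to [x]. *)
Lemma isometry_image_closed (F : set X) : linear_subspace F ->
  F `<=` norm_preserved T -> closed F -> closed (T @` F).
Proof.
move=> lF FE cF x clx.
pose G := filter_from (nbhs x) (fun B => F `&` T @^-1` B).
have GF : ProperFilter G.
  apply: filter_from_proper => [|B /clx[_ [[y Fy <-] By]]]; last by exists y.
  apply: filter_from_filter => [|B C xB xC]; first by exists setT; exact: filterT.
  by exists (B `&` C); [exact: filterI | move=> y [Fy []]].
have /cauchy_cvg cG : cauchy G.
  apply: cauchy_exP => e e0.
  (* Two images within [e / 2] of [x] are within [e] of each other, hence so are their preimages in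
     [F]. *)
  have xe2 : nbhs x (ball x (e / 2)) by apply: nbhsx_ballx; rewrite divr_gt0.
  have [_ [[y Fy <-] By]] := clx _ xe2.
  exists y, (ball x (e / 2)) => // z [Fz Bz].
  have := ball_splitr By Bz; rewrite -!ball_normE /= -linearB.
  by rewrite norm_preserved_isometry //; apply: FE; exact: linear_subspace_sub.
have Fl : F (lim G).
  by apply: cF => B /cG[C /clx[_ [[z Fz <-] Cz]] sub]; exists z; split=> //; exact: sub.
exists (lim G) => //; apply: (@cvg_unique X (@norm_hausdorff _ X) (T @ G) _).
  exact: (cvg_comp _ _ cG (contraction_continuous hT _)).
by move=> B xB; exists B => // z [].
Qed.

Definition unitary_part : set X :=
  \bigcap_n iter n (fun A => T @` A) (norm_preserved T).

(** The properties are proved together: closedness of the next image needs the current stage to be a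
    closed subspace of X(T), and [T]-stability keeps the next stage inside X(T). *)
Lemma iter_image_spec n (F := iter n (fun A => T @` A) (norm_preserved T)) :
  [/\ linear_subspace F, closed F, F `<=` norm_preserved T & T @` F `<=` F].
Proof.
rewrite {}/F; elim: n => [|n [lF cF FE TF]] /=.
  split=> //; first exact: norm_preserved_closed.
  by move=> _ [x Ex <-]; exact: norm_preserved_stable.
split; [exact: linear_subspace_image | exact: isometry_image_closed | |].
  exact: subset_trans TF FE.
exact: image_subset.
Qed.

Lemma unitary_part_invariant : invariant_subspace T unitary_part.
Proof.
split.
  by apply: linear_subspace_bigcap => n; have [] := iter_image_spec n.
move=> _ [x Wx <-] n _; have [_ _ _] := iter_image_spec n; apply.
by exists x => //; exact: Wx.
Qed.

Lemma unitary_part_unitary : unitary_on T unitary_part.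
Proof.
have isoE x : unitary_part x -> norm_preserved T x by move=> /(_ 0%N); apply.
split; first split; first exact: unitary_part_invariant.
  by move=> x Wx; apply/norm_preserved_isometry/isoE.
apply/seteqP; split; first by have [] := unitary_part_invariant.
(* The candidate preimage [y] comes from stage 1. Stage [n.+1] gives a preimage [z] in stage [n],
   and [z = y] because [T] is injective on the linear space X(T). *)
move=> x Wx; have [y Ey Tyx] := Wx 1%N I.
exists y => // n _; have [z Fz Tzx] := Wx n.+1 I.
have [_ _ FE _] := iter_image_spec n.
suff <- : z = y by [].
apply/eqP; rewrite -subr_eq0 -normr_eq0 -(@norm_preserved_isometry _ _ T).
  by rewrite linearB Tzx Tyx subrr normr0.
exact: (linear_subspace_sub _ _ _ hXT (FE _ Fz) Ey).
Qed.

Lemma unitary_part_largest : largest_unitary_subspace T unitary_part.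
Proof.
split.
- have [lW _] := unitary_part_invariant; split=> //.
  by apply: closed_bigI => n _; have [] := iter_image_spec n.
- exact: unitary_part_invariant.
- exact: unitary_part_unitary.
(* Since [M = T M], a point of [M] has a preimage in [M], which the induction places in stage
   [n]. *)
- move=> M _ uM x Mx n _; elim: n x Mx => [|n IH] x Mx /=.
    exact: (unitary_norm_preserved _ uM).
  have [_ TM] := uM; move: Mx; rewrite -{1}TM => -[y My <-].
  by exists y => //; exact: IH.
Qed.

End LargestUnitary.

Theorem theorem9p5 (R : realType) (X : completeNormedModType R[i])
    (T : {linear X -> X})
    (hT : contraction_on T setT)
    (hXT : linear_subspace (norm_preserved T))
    (hWold : Wold_isometry_on T (norm_preserved T))
    (hrange : right_complemented (norm_preserved T)
                (T @` norm_preserved T)) :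
  exists W : set X,
    unique (largest_unitary_subspace T) W /\
    (forall W' : set X,
       smooth W -> right_complement setT W W' ->
       contraction_on T W' /\ completely_nonunitary_on T W').

Proof.
have WP := unitary_part_largest hT hXT; exists (unitary_part (T := T)); split.
  split=> // W' [_ iW' uW' maxW']; have [_ iW uW maxW] := WP.
  by apply/seteqP; split; [exact: maxW' | exact: maxW].
move=> W' sW cW; have [_ _ uW maxW] := WP.
have [[/linear_subspaceP[W0 _] _ lW' _ [_ _ sum]] _] := cW.
split.
  apply: (contraction_on_invariant hT); split=> //.
  exact: (smooth_complement_invariant hT _ _ uW sW cW).
move=> [Y [YW' Y0 iY uY]]; apply: Y0.
have [/linear_subspaceP[Y0 _] _] := iY.
apply/seteqP; split=> [y Yy|_ ->] //=.
have /linear_subspaceP[W'0 _] := lW'.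
(* Both [y + 0] and [0 + y] decompose [y] along [W] and [W'], so uniqueness forces [y = 0]. *)
have [p [_ pU]] := sum y I.
have py : p = (y, 0) by apply: pU; split=> /=; [exact: maxW Yy | | rewrite addr0].
have p0 : p = (0, y) by apply: pU; split=> /=; [| exact: YW' | rewrite add0r].
by move: py; rewrite p0 => -[<-].
Qed.
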